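(* Let $n\ge 1$, let $N$ be a multiplicative, unitarily invariant, self-adjoint norm on $\mathbb{M}_n$, and let $\alpha_1,\alpha_2\in[0,\pi/2)$. If $X\in\mathbb{M}^s_{n,\alpha_1}$ and $Y\in\mathbb{M}^s_{n,\alpha_2}$, then $$\omega_N(X\circ Y)\le \sec(\alpha_1)\sec(\alpha_2)\,\omega_N(X)\,\omega_N(Y).$$
   Context: $\mathbb{M}_n$ is the algebra of $n\times n$ complex matrices, and $X\circ Y=[x_{ij}y_{ij}]$ is the Hadamard product of $X=[x_{ij}]$ and $Y=[y_{ij}]$. A norm $N$ on $\mathbb{M}_n$ is multiplicative if $N(XY)\le N(X)N(Y)$ (ordinary matrix product) for all $X,Y\in\mathbb{M}_n$; unitarily invariant if $N(UXV)=N(X)$ for all $X\in\mathbb{M}_n$ and all unitary $U,V\in\mathbb{M}_n$; self-adjoint if $N(X^* )=N(X)$ for all $X$. With $\operatorname{Re}(X)=\frac{X+X^*}{2}$, the generalized numerical radius induced by $N$ is $\omega_N(X)=\sup_{\theta\in\mathbb{R}}N(\operatorname{Re}(e^{i\theta}X))$. The numerical range of $X$ is $W(X)=\{\langle Xx,x\rangle: x\in\mathbb{C}^n,\ \|x\|=1\}$. For $\alpha\in[0,\pi/2)$, $S_\alpha=\{x+iy\in\mathbb{C}: x>0,\ |y|\le \tan(\alpha)\,x\}$, and $\mathbb{M}^s_{n,\alpha}$ is the class of all $X\in\mathbb{M}_n$ for which there is a complex number $z$ with $|z|=1$ and $W(zX)\subset S_\alpha$. *)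

(* Defs.v *)
From mathcomp Require Import all_boot all_order all_algebra.
From mathcomp Require Import all_classical all_reals.
From mathcomp Require Import trigo.
From mathcomp Require Import complex.

Set Implicit Arguments.
Unset Strict Implicit.
Unset Printing Implicit Defensive.

Import Order.TTheory GRing.Theory Num.Theory.
Local Open Scope classical_set_scope.
Local Open Scope ring_scope.
Local Open Scope sesquilinear_scope.
Local Open Scope complex_scope.

Section Norms.
Context {R : realType} {n : nat}.
Implicit Types (N : 'M[R[i]]_n -> R) (X Y U V : 'M[R[i]]_n).

(* Nonnegativity of [N] follows from the three conditions. *)
Definition mx_norm_axioms N :=
  [/\ forall X Y, N (X + Y) <= N X + N Y,
      forall (c : R[i]) X, N (c *: X) = Normc.normc c * N X &
      forall X, N X = 0 -> X = 0].

Definition multiplicative_norm N := forall X Y, N (X *m Y) <= N X * N Y.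

Definition unitarily_invariant N :=
  forall U X V, U \is unitarymx -> V \is unitarymx -> N (U *m X *m V) = N X.

Definition self_adjoint_norm N := forall X, N (X ^t*) = N X.

Definition mx_Re X : 'M[R[i]]_n := 2^-1 *: (X + X ^t*).

Definition expi (t : R) : R[i] := cos t +i* sin t.

(* The real supremum [sup] is [0] by convention on sets without a supremum;
   when [N] is a norm the set below is nonempty and bounded above
   (see [num_radius_has_sup]). *)
Definition num_radius N X : R :=
  sup [set N (mx_Re (expi t *: X)) | t in [set: R]].

End Norms.

Definition hadamard {R : realType} {n : nat} (X Y : 'M[R[i]]_n) : 'M[R[i]]_n :=
  map2_mx *%R X Y.

Section NumericalRange.
Context {R : realType} {n : nat}.

(* [dotmx] is the Hermitian product of row vectors, linear on the left. *)
Definition cdot (u v : 'cV[R[i]]_n) : R[i] := dotmx u^T v^T.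

Definition cnorm (u : 'cV[R[i]]_n) : R[i] := sqrtC (cdot u u).

Definition num_range (X : 'M[R[i]]_n) : set R[i] :=
  [set cdot (X *m x) x | x in [set x : 'cV[R[i]]_n | cnorm x = 1]].

End NumericalRange.

Definition sector {R : realType} (a : R) : set R[i] :=
  [set z | 0 < complex.Re z /\ `|complex.Im z| <= tan a * complex.Re z].

Definition sectorial {R : realType} {n : nat} (a : R) : set 'M[R[i]]_n :=
  [set X | exists z : R[i], `|z| = 1 /\ num_range (z *: X) `<=` sector a].

Definition sec {R : realType} (a : R) : R := (cos a)^-1.

Lemma normc_expi (R : realType) (t : R) : Normc.normc (expi t) = 1.
Proof. by rewrite /= cos2Dsin2 sqrtr1. Qed.

Lemma num_radius_has_sup (R : realType) (n : nat) (N : 'M[R[i]]_n -> R)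
    (X : 'M[R[i]]_n) : mx_norm_axioms N ->
  has_sup [set N (mx_Re (expi t *: X)) | t in [set: R]].
Proof.
move=> [ND NZ _]; split; first by exists (N (mx_Re (expi 0 *: X))), 0.
exists (Normc.normc 2^-1 * (N X + N (X ^t*))) => _ [t _ <-].
rewrite /mx_Re NZ ler_wpM2l //; first by case: (2^-1) => a b; apply: sqrtr_ge0.
apply: le_trans (ND _ _) _; rewrite NZ normc_expi mul1r lerD2l.
have -> : (expi t *: X) ^t* = expi (- t) *: X ^t*.
  apply/matrixP => i j; rewrite !mxE rmorphM; congr (_ * _).
  by rewrite /expi cosN sinN.
by rewrite NZ normc_expi mul1r.
Qed.

(* Main.v *)
(** For a unitarily invariant norm [N], singular value decomposition reduces
    [2 N(M) <= N(A) + N(B)] to the form inequality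
    [2 Re <Mv,u> <= <Au,u> + <Bv,v>] for all [u, v]: written in the singular
    bases of [M], the latter compares the singular values of [M] with diagonal
    entries, and passing to the diagonal part (pinching) does not increase [N].

    Two instances of this criterion suffice.  If [W(X)] lies in the sector
    [S_a], the form inequality holds with [A = B = sec a * Re X], so
    [N(X) <= sec a * N(Re X)].  If [W] is unitary, with [Y = U D V] it holds for
    [M = W o Y] and the diagonal parts of [U D U^*] and [V^* D V], so
    [N(W o Y) <= N(Y)].  Multiplicativity makes every singular value of [X] at
    most [N(X)], so [X / N(X)] is the mean of two unitary matrices and
    [N(X o Y) <= N(X) N(Y)].  The theorem follows since
    [N(Re(z X)) <= omega_N(X) <= N(X)] whenever [|z| = 1]. *)
Require Import Defs.
From mathcomp Require Import all_boot all_order all_algebra.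
From mathcomp Require Import all_classical all_reals.
From mathcomp Require Import trigo.
From mathcomp Require Import complex.
From mathcomp Require Import ring lra.

Set Implicit Arguments.
Unset Strict Implicit.
Unset Printing Implicit Defensive.

Import Order.TTheory GRing.Theory Num.Theory.
Local Open Scope classical_set_scope.
Local Open Scope ring_scope.
Local Open Scope sesquilinear_scope.

(** * Singular value decomposition and averages of unimodular numbers *)

Section ClosedFieldMatrices.
Context {C : numClosedFieldType}.

Lemma mulmx_adjE m n p (A : 'M[C]_(m, n)) (B : 'M[C]_(p, n)) i j :
  (A *m B^t*) i j = dotmx (row i A) (row j B).
Proof.
by rewrite dotmxE !mxE; apply: eq_bigr => k _; rewrite !mxE.
Qed.

Lemma unitary_adjK n (U : 'M[C]_n) : U \is unitarymx -> U^t* *m U = 1%:M.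
Proof. by rewrite -trmxC_unitary => /unitarymxP; rewrite trmxCK. Qed.

Lemma adj_diag_mx n (d : 'rV[C]_n) : (diag_mx d)^t* = diag_mx (map_mx Num.conj d).
Proof. by rewrite tr_diag_mx map_diag_mx. Qed.

Lemma diag_unitary n (d : 'rV[C]_n) :
  (forall j, `|d 0 j| = 1) -> diag_mx d \is unitarymx.
Proof.
move=> d1; apply/unitarymxP; rewrite adj_diag_mx mulmx_diag.
rewrite -diag_const_mx; congr diag_mx; apply/rowP => j.
by rewrite !mxE -normCK d1 expr1n.
Qed.

Lemma row_diag_mul m n (d : 'rV[C]_m) (A : 'M[C]_(m, n)) i :
  row i (diag_mx d *m A) = d 0 i *: row i A.
Proof. by apply/rowP => j; rewrite mul_diag_mx !mxE. Qed.

(** Induction on the number of zero rows. With none, dividing each row by its length gives [U];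
    otherwise a zero row is filled with a vector orthogonal to all rows, and its weight in [d] is
    afterwards reset to zero. *)
Lemma orthogonal_rows_decomposition n (P : 'M[C]_n) :
  (forall i j, i != j -> dotmx (row i P) (row j P) = 0) ->
  exists (d : 'rV[C]_n) (U : 'M[C]_n),
    [/\ U \is unitarymx, (forall j, 0 <= d 0 j) & P = diag_mx d *m U].
Proof.
have [k] := ubnP #|[set j | row j P == 0]%SET|.
elim: k P => // k IHk P le_k oP.
have [/existsP[j /eqP Pj0]|nzP] := boolP [exists j, row j P == 0]; last first.
  pose e : 'rV[C]_n := \row_j sqrtC (dotmx (row j P) (row j P)).
  have e_gt0 j : 0 < e 0 j.
    rewrite mxE sqrtC_gt0 dnorm_gt0; apply: contra nzP => Pj0.
    by apply/existsP; exists j.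
  exists e, (diag_mx (\row_j (e 0 j)^-1) *m P); split.
  - apply/row_unitarymxP => i j.
    rewrite !row_diag_mul linearZl_LR linearZr_LR /= (mxE _ _ 0 i) (mxE _ _ 0 j).
    have [<-|nij] := eqVneq i j; last by rewrite oP // !mulr0.
    have -> : dotmx (row i P) (row i P) = e 0 i ^+ 2 by rewrite mxE sqrtCK.
    rewrite geC0_conj ?invr_ge0 ?ltW // expr2 mulKf ?gt_eqF //.
    by rewrite mulVf ?gt_eqF.
  - by move=> j; rewrite ltW.
  - rewrite mulmxA mulmx_diag.
    rewrite -[LHS]mul1mx -diag_const_mx; congr (diag_mx _ *m _).
    by apply/rowP => j; rewrite mxE [in RHS]mxE [X in _ * X]mxE mulfV ?gt_eqF.
(* A zero row makes [P^t*] singular. A nonzero [w] with [w *m P^t* = 0] is orthogonal to every row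
   of [P], so it can fill row [j]. *)
have : \det (P^t*) == 0.
  rewrite det_map_mx det_tr conjC_eq0; apply/det0P.
  exists (delta_mx 0 j); last by rewrite -rowE.
  apply/eqP => /matrixP/(_ 0 j); rewrite !mxE !eqxx /= => /eqP.
  by rewrite oner_eq0.
case/det0P => w nzw wP.
have oPw i : dotmx w (row i P) = 0.
  have := mulmx_adjE w P 0 i; rewrite wP mxE => ->.
  by congr dotmx; apply/rowP => l; rewrite mxE.
pose P' := \matrix_i (if i == j then w else row i P).
have [||d [U [uU d0 P'E]]] := IHk P'.
- rewrite ltnS in le_k; apply: leq_trans le_k; apply: proper_card; apply/properP.
  split; last first.
    by exists j; rewrite !inE ?Pj0 // rowK eqxx.
  apply/fintype.subsetP => i; rewrite !inE rowK; case: (i =P j) => // -> /eqP w0.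
  by rewrite w0 eqxx in nzw.
- move=> i l nil; rewrite !rowK.
  case: (i =P j) => [ij|_]; case: (l =P j) => [lj|_]; rewrite ?oPw ?oP //.
  + by rewrite ij lj eqxx in nil.
  + by rewrite hermC /= oPw rmorph0 mulr0.
exists (\row_i (if i == j then 0 else d 0 i)), U; split=> //.
  by move=> i; rewrite mxE; case: ifP.
apply/row_matrixP => i; rewrite row_diag_mul mxE.
have := rowK (fun i => if i == j then w else row i P) i.
rewrite -/P' P'E row_diag_mul; case: (i =P j) => [->|_] // _.
by rewrite Pj0 scale0r.
Qed.

(** Diagonalizing [M *m M^t*] by a unitary [V] makes the rows of [V *m M] pairwise orthogonal; the
    row decomposition then supplies the singular values and the other unitary factor. *)
Lemma svd n (M : 'M[C]_n) :
  exists (U V : 'M[C]_n) (d : 'rV[C]_n),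
    [/\ U \is unitarymx, V \is unitarymx, (forall j, 0 <= d 0 j)
      & M = U *m diag_mx d *m V].
Proof.
have nH : M *m M^t* \is normalmx.
  by apply/normalmxP; rewrite !trmx_mul !map_mxM /= !trmxCK.
have := orthomx_spectralP nH.
have := spectral_unitarymx (M *m M^t*).
move: (spectralmx _) (spectral_diag _) => V s uV HE.
have [i j nij|d [U [uU d0 VM]]] := @orthogonal_rows_decomposition _ (V *m M).
  rewrite -mulmx_adjE trmx_mul map_mxM !mulmxA -(mulmxA V) HE invmx_unitary //.
  rewrite !mulmxA (unitarymxP uV) mul1mx mulmxtVK //.
  by rewrite mxE (negbTE nij).
exists (V^t*), U, d; split; rewrite ?trmxC_unitary //.
by rewrite -mulmxA -VM mulmxA unitary_adjK // mul1mx.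
Qed.

(* The two unimodular numbers are [c +- i sqrt (1 - c^2)]. *)
Lemma unit_interval_average (c : C) : 0 <= c <= 1 ->
  exists a b : C, [/\ `|a| = 1, `|b| = 1 & c = 2^-1 * (a + b)].
Proof.
case/andP=> c0 c1; pose s := sqrtC (1 - c ^+ 2).
have s0 : 0 <= s by rewrite sqrtC_ge0 subr_ge0 expr_le1.
have rc := ger0_real c0; have rs := ger0_real s0.
have sE : s ^+ 2 = 1 - c ^+ 2 by rewrite sqrtCK.
exists (c + 'i * s), (c - 'i * s); split.
- by apply/eqP; rewrite -sqrp_eq1 // normC2_rect // sE addrC subrK.
- rewrite -mulrN; apply/eqP; rewrite -sqrp_eq1 // normC2_rect ?rpredN //.
  by rewrite sqrrN sE addrC subrK.
- by field.
Qed.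

End ClosedFieldMatrices.

(** * Sesquilinear forms and the bound for sectorial matrices *)

Section SesquilinearForms.
Context {C : numClosedFieldType} {n : nat}.
Implicit Types (M A B X : 'M[C]_n) (u v w x : 'cV[C]_n).

(** This is [<Mv,u>], conjugate-linear in [u]. *)
Definition sform M u v : C := (u^t* *m M *m v) 0 0.

Lemma sformDl M u v w : sform M (u + v) w = sform M u w + sform M v w.
Proof. by rewrite /sform raddfD /= map_mxD !mulmxDl mxE. Qed.

Lemma sformDr M u v w : sform M u (v + w) = sform M u v + sform M u w.
Proof. by rewrite /sform mulmxDr mxE. Qed.

Lemma sformZl M a u v : sform M (a *: u) v = a^* * sform M u v.
Proof. by rewrite /sform linearZ /= map_mxZ -!scalemxAl mxE. Qed.

Lemma sformZr M a u v : sform M u (a *: v) = a * sform M u v.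
Proof. by rewrite /sform -scalemxAr mxE. Qed.

Lemma sformNl M u v : sform M (- u) v = - sform M u v.
Proof. by rewrite -scaleN1r sformZl rmorphN rmorph1 mulN1r. Qed.

Lemma sformNr M u v : sform M u (- v) = - sform M u v.
Proof. by rewrite -scaleN1r sformZr mulN1r. Qed.

Lemma sformDm A B u v : sform (A + B) u v = sform A u v + sform B u v.
Proof. by rewrite /sform mulmxDr mulmxDl mxE. Qed.

Lemma sformZm a M u v : sform (a *: M) u v = a * sform M u v.
Proof. by rewrite /sform -scalemxAr -scalemxAl mxE. Qed.

Lemma sformM A B u v : sform (A *m B) u v = sform A u (B *m v).
Proof. by rewrite /sform !mulmxA. Qed.

Lemma sform_adj M u v : sform (M^t*) u v = (sform M v u)^*.
Proof.
rewrite /sform; set Z := _ *m v.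
have -> : Z = (v^t* *m M *m u)^t*.
  by rewrite /Z !trmx_mul !map_mxM /= trmxCK mulmxA.
by rewrite !mxE.
Qed.

Lemma mulmx_sformE (U M V : 'M[C]_n) i j :
  (U^t* *m M *m V) i j = sform M (col i U) (col j V).
Proof.
rewrite /sform -map_trmx tr_col map_row -!row_mul map_trmx.
by rewrite !mxE; apply: eq_bigr => k _; rewrite !mxE.
Qed.

(** A nonzero left null vector [w] of [A] would make the form vanish at [w^t*]. *)
Lemma positive_form_unitmx A :
  (forall x, x != 0 -> sform A x x != 0) -> A \in unitmx.
Proof.
move=> pA; rewrite unitmxE unitfE; apply/negP => /det0P[w nzw wA].
have := pA (w^t*); rewrite /sform trmxCK wA mul0mx mxE eqxx.
suff -> : w^t* != 0 by move/(_ isT).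
by apply: contra nzw => /eqP w0; rewrite -[w]trmxCK w0 trmx0 map_mx0.
Qed.

(* With [X = A + iB], [y = A^-1 B v] and [w = A^-1 X v = v + i y], the bound is
   positivity of [A] at [c u - w] once [<Ay,y> <= t^2 <Av,v>] is known; the
   latter follows by polarizing [B] between [t v] and [y]. *)
Lemma sectorial_form_bound X (t c : C) : 0 <= t -> 0 < c ->
    c ^+ 2 = 1 + t ^+ 2 ->
    (forall x, x != 0 -> 0 < 'Re (sform X x x) /\
       `|'Im (sform X x x)| <= t * 'Re (sform X x x)) ->
  let A := 2^-1 *: (X + X^t*) in
  forall u v, sform X u v + (sform X u v)^* <= c * (sform A u u + sform A v v).
Proof.
move=> t0 c0 c2 sX A u v; pose B := (2 * 'i)^-1 *: (X - X^t*).
have nzi : 'i != 0 :> C := neq0Ci C.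
have i2 : 'i ^+ 2 = -1 :> C := sqrCi C.
have XE : X = A + 'i *: B.
  by apply/matrixP => i j; rewrite !mxE; field.
have Ah x y : (sform A x y)^* = sform A y x.
  rewrite -sform_adj; congr sform.
  by apply/matrixP => i j; rewrite !mxE rmorphM rmorphD fmorphV /= conjCK
     conjC_nat addrC.
have Bh x y : (sform B x y)^* = sform B y x.
  rewrite -sform_adj; congr sform; apply/matrixP => i j.
  rewrite !mxE rmorphM rmorphB fmorphV rmorphM /= conjCK conjC_nat conjCi.
  by rewrite mulrN invrN mulNr -mulrN opprB.
have AE x : sform A x x = 'Re (sform X x x).
  by rewrite /A sformZm sformDm sform_adj ReE mulrC.
have BE x : sform B x x = 'Im (sform X x x).
  rewrite /B sformZm sformDm -scaleN1r sformZm sform_adj ImE.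
  set p := sform X x x.
  by transitivity ('i ^+ 2 * (p^* - p) / (2 * 'i)); [rewrite i2|]; field.
have uA : A \in unitmx.
  by apply: positive_form_unitmx => x /sX[+ _]; rewrite AE => /gt_eqF->.
have A0 x : 0 <= sform A x x.
  have [->|/sX[+ _]] := eqVneq x 0; last by rewrite AE; apply: ltW.
  by rewrite /sform mulmx0 mxE.
have B_le x : `|sform B x x| <= t * sform A x x.
  have [->|/sX[_]] := eqVneq x 0; last by rewrite BE AE.
  by rewrite /sform !mulmx0 !mxE normr0 mulr0.
pose y := invmx A *m (B *m v); pose w := v + 'i *: y.
have Ay x : sform A x y = sform B x v.
  by rewrite -[LHS]sformM mulmxV // -sformM mul1mx.
set a := sform A v v; set q := sform A y y.
have Bvy : sform B v y = q by rewrite -Bh -Ay Ah.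
have q_le : q <= t ^+ 2 * a.
  have polar s : s^* = s -> 4 * s * q =
      sform B (s *: v + y) (s *: v + y) - sform B (s *: v - y) (s *: v - y).
    move=> sr; rewrite !(sformDl, sformDr, sformNl, sformNr, sformZl, sformZr).
    by rewrite sr -(Ay y) Bvy -/q; ring.
  have paral s : s^* = s -> 2 * (s ^+ 2 * a + q) =
      sform A (s *: v + y) (s *: v + y) + sform A (s *: v - y) (s *: v - y).
    move=> sr; rewrite !(sformDl, sformDr, sformNl, sformNr, sformZl, sformZr).
    by rewrite sr -/a -/q; ring.
  have bound s : 0 <= s -> 4 * s * q <= t * (2 * (s ^+ 2 * a + q)).
    move=> s0; have sr : s^* = s := geC0_conj s0.
    rewrite polar // paral // mulrDr; apply: le_trans (real_ler_norm _) _.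
      by rewrite rpredB // BE Creal_Im.
    by apply: le_trans (ler_normB _ _) _; apply: lerD.
  (* The choice [s = t] gives the claim after division by [2 * t]. For [t = 0] it is void, and
     [s = 1] yields [q <= 0] instead. *)
  have [t_eq0|tn0] := eqVneq t 0.
    have := bound 1 ler01; rewrite t_eq0 expr0n /= !mul0r mulr1.
    by rewrite pmulr_rle0 // ltr0n.
  have t_gt0 : 0 < t by rewrite lt_def tn0.
  have := bound t t0; rewrite -subr_ge0.
  have -> : t * (2 * (t ^+ 2 * a + q)) - 4 * t * q
              = 2 * t * (t ^+ 2 * a - q) by ring.
  by rewrite pmulr_rge0 ?mulr_gt0 ?ltr0n // subr_ge0.
have fww : sform A w w = a + q.
  rewrite /w !(sformDl, sformDr, sformZl, sformZr) -(Ah v y) Ay.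
  rewrite Bh conjCi -/a -/q.
  by transitivity (a - 'i ^+ 2 * q); [|rewrite i2]; ring.
have fuw : sform X u v = sform A u w.
  by rewrite XE sformDm (sformZm 'i) /w sformDr sformZr Ay.
have cr : c^* = c := geC0_conj (ltW c0).
clearbody w; have := A0 (c *: u - w).
rewrite !(sformDl, sformDr, sformNl, sformNr, sformZl, sformZr) cr -(Ah u w).
rewrite fww -fuw => pos.
rewrite -(ler_pM2l c0) -subr_ge0; apply: le_trans pos _; rewrite -subr_ge0.
set p := sform X u v; set b := sform A u u.
(* Once the goal is multiplied by [c], it exceeds the positivity at [c *: u - w] by
   [t ^+ 2 * a - q], which [q_le] makes nonnegative. *)
have -> : c * (c * (b + a)) - c * (p + p^*) -
    (c * (c * b - p) - (c * p^* - (a + q))) = (c ^+ 2 - 1) * a - q by ring.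
by rewrite c2 (addrC 1) addrK subr_ge0.
Qed.

End SesquilinearForms.

Lemma unitarymx1 (C : numClosedFieldType) n : (1%:M : 'M[C]_n) \is unitarymx.
Proof. by apply/unitarymxP; rewrite trmx1 map_mx1 mulmx1. Qed.

Lemma diag_contraction_average (C : numClosedFieldType) n (f : 'rV[C]_n) :
  (forall j, 0 <= f 0 j <= 1) ->
  exists W1 W2 : 'M[C]_n,
    [/\ W1 \is unitarymx, W2 \is unitarymx
      & diag_mx f = 2^-1 *: (W1 + W2)].
Proof.
move=> f01.
have /boolp.choice[g gP] (j : 'I_n) : exists ab : C * C,
    [/\ `|ab.1| = 1, `|ab.2| = 1 & f 0 j = 2^-1 * (ab.1 + ab.2)].
  by have [a [b abP]] := unit_interval_average (f01 j); exists (a, b).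
exists (diag_mx (\row_j (g j).1)), (diag_mx (\row_j (g j).2)); split.
- by apply: diag_unitary => j; rewrite mxE; case: (gP j).
- by apply: diag_unitary => j; rewrite mxE; case: (gP j).
rewrite -raddfD -linearZ /=; congr diag_mx; apply/rowP => j.
by rewrite !mxE; case: (gP j).
Qed.

(** * Diagonal contractions, pinching and the form criterion *)

Section UnitarilyInvariantNorms.
Context {R : realType} {n : nat} (N : 'M[R[i]]_n -> R).
Context (hN : mx_norm_axioms N).
Context (hui : unitarily_invariant N).
Implicit Types (X Y Z U V A B M : 'M[R[i]]_n).

Lemma normD X Y : N (X + Y) <= N X + N Y. Proof. by case: hN. Qed.

Lemma normZ c X : N (c *: X) = complex.Re `|c| * N X.
Proof. by case: hN => _ NZ _; rewrite NZ normc_def; case: c. Qed.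

Lemma normZ_ge0 c X : 0 <= c -> N (c *: X) = complex.Re c * N X.
Proof. by move=> c0; rewrite normZ ger0_norm. Qed.

Lemma norm0 : N 0 = 0.
Proof. by have := normZ 0 0; rewrite scale0r normr0 mul0r. Qed.

Lemma norm0_eq0 X : N X = 0 -> X = 0. Proof. by case: hN => _ _; apply. Qed.

Lemma norm_ge0 X : 0 <= N X.
Proof.
have := normD X (- X); rewrite subrr norm0 -scaleN1r normZ normrN1 /= mul1r.
by lra.
Qed.

Lemma norm_half_le X Y M : N X <= N M -> N Y <= N M ->
  N (2^-1 *: (X + Y)) <= N M.
Proof.
move=> XM YM; have -> : 2^-1 = (2^-1)%:C%C :> R[i] by rewrite fmorphV rmorph_nat.
rewrite normZ_ge0 ?ler0c ?invr_ge0 //=.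
by have := normD X Y; lra.
Qed.

Lemma norm_unitaryl U X : U \is unitarymx -> N (U *m X) = N X.
Proof.
by move=> uU; have := hui X uU (unitarymx1 _ _); rewrite mulmx1.
Qed.

(** A diagonal contraction is the mean of two unitary matrices, and left multiplication by each of
    them preserves [N]. *)
Lemma norm_diag_contraction (f : 'rV[R[i]]_n) X :
  (forall j, 0 <= f 0 j <= 1) -> N (diag_mx f *m X) <= N X.
Proof.
move=> /diag_contraction_average[W1 [W2 [u1 u2 ->]]].
rewrite -scalemxAl mulmxDl.
by apply: norm_half_le; rewrite norm_unitaryl ?u1 ?u2.
Qed.

(** The quotients of [d] by [e] form a diagonal contraction carrying [e] to [d]. Where [e] vanishes
    so does [d], and the quotient is zero by convention. *)
Lemma le_norm_diag (d e : 'rV[R[i]]_n) : (forall j, 0 <= d 0 j <= e 0 j) ->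
  N (diag_mx d) <= N (diag_mx e).
Proof.
move=> de; have -> : diag_mx d = diag_mx (\row_j (d 0 j / e 0 j)) *m diag_mx e.
  rewrite mulmx_diag; congr diag_mx; apply/rowP => j; rewrite !mxE.
  have [e0|nz] := eqVneq (e 0 j) 0; last by rewrite divfK.
  by rewrite e0 mulr0; apply/le_anti; rewrite -{1}e0 andbC.
apply: norm_diag_contraction => j; rewrite mxE; have /andP[d0 dle] := de j.
have e0 := le_trans d0 dle; rewrite divr_ge0 //=.
have [->|nz] := eqVneq (e 0 j) 0; first by rewrite invr0 mulr0 ler01.
by rewrite ler_pdivrMr ?mul1r // lt_def nz.
Qed.

(** Interpolates between [Z], for empty [s], and its diagonal part, once [s] lists every index, so
    that an induction on [s] can clear one index at a time. *)
Definition pinch (s : seq 'I_n) Z : 'M[R[i]]_n :=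
  \matrix_(i, j) if (i == j) || ((i \notin s) && (j \notin s)) then Z i j else 0.

(* Conjugating by the diagonal reflection at [k] flips the sign of the
   off-diagonal entries of row and column [k], so averaging removes them. *)
Lemma norm_pinch s Z : N (pinch s Z) <= N Z.
Proof.
elim: s => [|k s IHs].
  rewrite le_eqVlt; apply/orP; left; apply/eqP; congr N.
  by apply/matrixP => i j; rewrite mxE orbT.
pose J := diag_mx (\row_j (-1) ^+ (j == k)) : 'M[R[i]]_n.
have uJ : J \is unitarymx.
  by apply: diag_unitary => j; rewrite mxE normrX normrN1 expr1n.
suff -> : pinch (k :: s) Z =
    2^-1 *: (pinch s Z + J *m pinch s Z *m J).
  by apply: norm_half_le; rewrite // hui.
apply/matrixP => i j; rewrite mul_mx_diag mul_diag_mx !mxE !inE.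
have [->|nij] /= := eqVneq i j.
  by case: (j == k); rewrite ?expr0 ?expr1; field.
have [ik|nik] /= := eqVneq i k; have [jk|njk] /= := eqVneq j k;
  rewrite ?expr0 ?expr1 ?andbF.
- by rewrite ik jk eqxx in nij.
- by field.
- by field.
- by field.
Qed.

Lemma norm_diagonal_part Z : N (diag_mx (\row_j Z j j)) <= N Z.
Proof.
have -> : diag_mx (\row_j Z j j) = pinch (enum 'I_n) Z; last exact: norm_pinch.
apply/matrixP => i j; rewrite !mxE !mem_enum /= orbF.
by case: eqVneq => [->|_]; rewrite ?mulr1n ?mulr0n.
Qed.

Lemma norm_le_of_form M A B :
  (forall u v, sform M u v + (sform M u v)^* <= sform A u u + sform B v v) ->
  2 * N M <= N A + N B.
Proof.
move=> MAB; have [U [V [d [uU uV d0 ME]]]] := svd M.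
(* In the singular bases [M] becomes [diag_mx d], so the hypothesis at the [j]-th columns of [U] and
   [V^t*] bounds [2 * d 0 j] by [Z j j]. *)
pose Z := U^t* *m A *m U + V *m B *m V^t*.
have NZ : N Z <= N A + N B.
  have uUt : U^t* \is unitarymx by rewrite trmxC_unitary.
  have uVt : V^t* \is unitarymx by rewrite trmxC_unitary.
  by apply: le_trans (normD _ _) _; rewrite (hui A uUt uU) (hui B uV uVt).
have dZ j : 0 <= (2 *: d) 0 j <= (\row_j Z j j) 0 j.
  have dE : d 0 j = sform M (col j U) (col j (V^t*)).
    rewrite -mulmx_sformE ME !mulmxA unitary_adjK // mul1mx mulmxtVK //.
    by rewrite mxE eqxx.
  have ZE : Z j j = sform A (col j U) (col j U)
                    + sform B (col j (V^t*)) (col j (V^t*)).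
    by rewrite -!mulmx_sformE trmxCK mxE.
  have := MAB (col j U) (col j (V^t*)).
  rewrite -dE -ZE geC0_conj // [(2 *: d) 0 j]mxE [(\row__ _) 0 j]mxE.
  by rewrite -mulr2n mulr_natl => ->; rewrite mulrn_wge0.
apply: le_trans NZ; apply: le_trans (norm_diagonal_part Z).
apply: le_trans (le_norm_diag dZ).
rewrite linearZ /= -(rmorph_nat (real_complex R)) normZ_ge0 ?ler0c //=.
by rewrite ME (hui _ uU uV).
Qed.

End UnitarilyInvariantNorms.

(** * Forms of Hadamard products with a unitary factor *)

Section HadamardForms.
Context {C : numClosedFieldType} {n : nat}.
Implicit Types (M W Y : 'M[C]_n) (u v : 'cV[C]_n).

Lemma sformE M u v :
  sform M u v = \sum_i \sum_j (u i 0)^* * M i j * v j 0.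
Proof.
rewrite /sform -mulmxA mxE; apply: eq_bigr => i _; rewrite !mxE mulr_sumr.
by apply: eq_bigr => j _; rewrite mulrA.
Qed.

Lemma sform_diag (d : 'rV[C]_n) u : sform (diag_mx d) u u =
  \sum_i d 0 i * (u i 0 * (u i 0)^*).
Proof.
rewrite sformE; apply: eq_bigr => i _; rewrite (bigD1 i) //= big1 => [|j ji].
  by rewrite mxE eqxx mulr1n addr0; ring.
by rewrite mxE eq_sym (negbTE ji) mulr0n mulr0 mul0r.
Qed.

(** This is [|u - Wv|^2 >= 0] expanded, with [|Wv| = |v|]. *)
Lemma sform_unitary_le W u v : W \is unitarymx ->
  sform W u v + (sform W u v)^* <= sform 1%:M u u + sform 1%:M v v.
Proof.
move=> uW; have one (x : 'cV[C]_n) : sform 1%:M x x = dotmx x^T x^T.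
  rewrite dotmxE /sform mulmx1 !mxE.
  by apply: eq_bigr => i _; rewrite !mxE mulrC.
have WE x y : sform 1%:M x (W *m y) = sform W x y by rewrite -sformM mul1mx.
have h1 (x y : 'cV[C]_n) : (sform 1%:M x y)^* = sform 1%:M y x.
  by rewrite -sform_adj trmx1 map_mx1.
have WW : sform 1%:M (W *m v) (W *m v) = sform 1%:M v v.
  rewrite /sform trmx_mul map_mxM /= !mulmxA !mulmx1 -(mulmxA _ _ W).
  by rewrite unitary_adjK // mulmx1.
have : 0 <= sform 1%:M (u - W *m v) (u - W *m v).
  by rewrite one; apply: (dnorm_ge0 (@dotmx C n)).
rewrite !(sformDl, sformDr, sformNl, sformNr) -(h1 u (W *m v)) WW !WE => pos.
rewrite -subr_ge0; apply: le_trans pos _; rewrite le_eqVlt; apply/orP; left.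
by apply/eqP; ring.
Qed.

(* Expanding [Y = U D V] turns the form of [W o Y] into a combination of forms
   of [W] with the singular values of [Y] as weights. *)
Lemma hadamard_unitary_form_le W (U V : 'M[C]_n) (d : 'rV[C]_n) :
  W \is unitarymx -> (forall k, 0 <= d 0 k) ->
  let M := map2_mx *%R W (U *m diag_mx d *m V) in
  let A := diag_mx (\row_j (U *m diag_mx d *m U^t*) j j) in
  let B := diag_mx (\row_j (V^t* *m diag_mx d *m V) j j) in
  forall u v, sform M u v + (sform M u v)^* <= sform A u u + sform B v v.
Proof.
move=> uW d0 M A B u v.
(* Column [k] of [U] and row [k] of [V] are absorbed into [u] and [v]; [U i k] is conjugated because
   the form conjugates its first argument. *)
pose a k : 'cV[C]_n := \col_i (u i 0 * (U i k)^*).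
pose b k : 'cV[C]_n := \col_i (V k i * v i 0).
have ME : sform M u v = \sum_k d 0 k * sform W (a k) (b k).
  rewrite sformE; under [RHS]eq_bigr do rewrite sformE mulr_sumr.
  rewrite [RHS]exchange_big; apply: eq_bigr => i _ /=.
  under [RHS]eq_bigr do rewrite mulr_sumr.
  rewrite [RHS]exchange_big; apply: eq_bigr => j _ /=.
  rewrite mxE mul_mx_diag mxE mulr_sumr mulr_sumr mulr_suml.
  apply: eq_bigr => k _; rewrite !mxE rmorphM /= conjCK; ring.
have AE : sform A u u = \sum_k d 0 k * sform 1%:M (a k) (a k).
  under [RHS]eq_bigr do rewrite -diag_const_mx sform_diag mulr_sumr.
  rewrite sform_diag [RHS]exchange_big; apply: eq_bigr => i _ /=.
  rewrite mxE mul_mx_diag mxE mulr_suml; apply: eq_bigr => k _.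
  by rewrite !mxE rmorphM /= conjCK; ring.
have BE : sform B v v = \sum_k d 0 k * sform 1%:M (b k) (b k).
  under [RHS]eq_bigr do rewrite -diag_const_mx sform_diag mulr_sumr.
  rewrite sform_diag [RHS]exchange_big; apply: eq_bigr => i _ /=.
  rewrite mxE mul_mx_diag mxE mulr_suml; apply: eq_bigr => k _.
  by rewrite !mxE rmorphM /=; ring.
rewrite ME AE BE rmorph_sum -!big_split /=; apply: ler_sum => k _.
rewrite rmorphM /= geC0_conj // -!mulrDr ler_wpM2l //.
exact: sform_unitary_le.
Qed.

End HadamardForms.

(** * Hadamard products under multiplicative norms *)

Lemma hadamardDl (R : realType) n (X1 X2 Y : 'M[R[i]]_n) :
  hadamard (X1 + X2) Y = hadamard X1 Y + hadamard X2 Y.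
Proof. by apply/matrixP => i j; rewrite !mxE mulrDl. Qed.

Lemma hadamardZl (R : realType) n (c : R[i]) (X Y : 'M[R[i]]_n) :
  hadamard (c *: X) Y = c *: hadamard X Y.
Proof. by apply/matrixP => i j; rewrite !mxE mulrA. Qed.

Section MultiplicativeNorms.
Context {R : realType} {n : nat} (N : 'M[R[i]]_n -> R).
Context (hN : mx_norm_axioms N).
Context (hui : unitarily_invariant N).
Context (hmul : multiplicative_norm N).
Implicit Types (X Y U V W : 'M[R[i]]_n).

Lemma norm_hadamard_unitary W Y : W \is unitarymx -> N (hadamard W Y) <= N Y.
Proof.
move=> uW; have [U [V [d [uU uV d0 ->]]]] := svd Y.
have := norm_le_of_form hN hui (hadamard_unitary_form_le U V uW d0).
have uUt : U^t* \is unitarymx by rewrite trmxC_unitary.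
have uVt : V^t* \is unitarymx by rewrite trmxC_unitary.
(* Both diagonal parts come from unitary conjugates of [diag_mx d], so their norms are at most
   [N (diag_mx d)], the norm of the original [Y]. *)
have := norm_diagonal_part hN hui (U *m diag_mx d *m U^t*).
have := norm_diagonal_part hN hui (V^t* *m diag_mx d *m V).
rewrite (hui _ uU uUt) (hui _ uVt uV) (hui _ uU uV) /hadamard.
set a := N _; set b := N _; set c := N _; set e := N _.
lra.
Qed.

(** The coordinate projection [P] is a nonzero idempotent, so multiplicativity forces [N P >= 1].
    Multiplying [diag_mx d] by [P] leaves [d 0 j *: P] and does not increase [N]. *)
Lemma singular_value_le_norm U V (d : 'rV[R[i]]_n) j :
  U \is unitarymx -> V \is unitarymx -> 0 <= d 0 j ->
  complex.Re (d 0 j) <= N (U *m diag_mx d *m V).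
Proof.
move=> uU uV d0; rewrite (hui _ uU uV).
pose P : 'M[R[i]]_n := diag_mx (delta_mx 0 j).
have PP : P *m P = P.
  rewrite mulmx_diag; congr diag_mx; apply/rowP => k.
  by rewrite !mxE; case: (_ && _); rewrite ?mulr1 ?mulr0.
have nzP : N P != 0.
  apply/eqP => /(norm0_eq0 hN)/matrixP/(_ j j); rewrite !mxE !eqxx => /eqP.
  by rewrite oner_eq0.
have P_ge1 : 1 <= N P.
  have := hmul P P; rewrite PP => le_PP.
  have P_gt0 : 0 < N P by rewrite lt_def nzP (norm_ge0 hN).
  by rewrite -(ler_pM2l P_gt0) mulr1.
have dP : diag_mx (delta_mx 0 j) *m diag_mx d = d 0 j *: P.
  rewrite mulmx_diag -linearZ /=; congr diag_mx; apply/rowP => k.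
  rewrite !mxE; have [->|_] := eqVneq k j; first by rewrite mulrC.
  by rewrite /= mulr0 mul0r.
have : N (diag_mx (delta_mx 0 j) *m diag_mx d) <= N (diag_mx d).
  apply: norm_diag_contraction => // k.
  by rewrite mxE ler0n lern1 leq_b1.
rewrite dP normZ_ge0 //; apply: le_trans.
have : 0 <= complex.Re (d 0 j) by move: d0; rewrite lecE => /andP[_].
by move=> r0; rewrite -{1}[complex.Re _]mulr1; apply: ler_wpM2l.
Qed.

Lemma norm_hadamard X Y : N (hadamard X Y) <= N X * N Y.
Proof.
have [X0|nzX] := eqVneq (N X) 0.
  rewrite (norm0_eq0 hN X0) (_ : hadamard 0 Y = 0) ?(norm0 hN) ?mul0r //.
  by apply/matrixP => i j; rewrite !mxE mul0r.
have X_gt0 : 0 < N X by rewrite lt_def nzX (norm_ge0 hN).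
have [U [V [d [uU uV d0 XE]]]] := svd X.
pose r : R[i] := (N X)%:C%C.
have r_gt0 : 0 < r by rewrite ltcR.
have f01 j : 0 <= (r^-1 *: d) 0 j <= 1.
  rewrite mxE mulr_ge0 ?invr_ge0 ?(ltW r_gt0) // ler_pdivrMl // mulr1.
  have := singular_value_le_norm uU uV (d0 j); rewrite -XE -lecR.
  by rewrite RRe_real // ger0_real.
have [W1 [W2 [u1 u2 fE]]] := diag_contraction_average f01.
have uUV W : W \is unitarymx -> U *m W *m V \is unitarymx.
  by move=> uW; exact: mul_unitarymx (mul_unitarymx uU uW) uV.
have {}XE : X = r *: (2^-1 *: (U *m W1 *m V + U *m W2 *m V)).
  rewrite -mulmxDl -mulmxDr (scalemxAl 2^-1) (scalemxAr 2^-1) -fE.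
  rewrite linearZ /= -scalemxAr -scalemxAl -XE scalerA mulfV ?gt_eqF //.
  by rewrite scale1r.
rewrite {1}XE !hadamardZl hadamardDl (normZ_ge0 hN) ?(ltW r_gt0) //.
apply: (@ler_wpM2l _ (N X)); first exact: norm_ge0.
apply: (norm_half_le hN).
  exact: norm_hadamard_unitary (uUV _ u1).
exact: norm_hadamard_unitary (uUV _ u2).
Qed.

End MultiplicativeNorms.

(** * The numerical radius and sectorial matrices *)

Section NumericalRadius.
Context {R : realType} {n : nat} (N : 'M[R[i]]_n -> R).
Context (hN : mx_norm_axioms N).
Implicit Types (X : 'M[R[i]]_n).

(** Each real part is the mean of [expi t *: X] and its adjoint, which both have norm [N X]. *)
Lemma num_radius_le X : self_adjoint_norm N -> num_radius N X <= N X.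
Proof.
move=> hsa; apply: ge_sup; first by exists (N (mx_Re (expi 0 *: X))), 0.
move=> _ [t _ <-].
have eX : N (expi t *: X) = N X.
  by case: hN => _ NZ _; rewrite NZ normc_expi mul1r.
by rewrite -[leRHS]eX; apply: norm_half_le; rewrite // hsa.
Qed.

Lemma unit_complex_expi (z : R[i]) : `|z| = 1 -> exists t, z = expi t.
Proof.
case: z => a b; rewrite normc_def /= => -[/(congr1 (fun x => x ^+ 2))].
rewrite expr1n sqr_sqrtr ?addr_ge0 ?sqr_ge0 // => ab.
have a1 : -1 <= a <= 1 by have b0 := sqr_ge0 b; apply/andP; split; nra.
have ca : cos (acos a) = a by apply: acosK; rewrite in_itv.
have sa : sin (acos a) = `|b|.
  by rewrite sin_acos // -ab addrC addKr sqrtr_sqr.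
(* The cosine fixes the angle up to sign, and the sign of [b] selects it. *)
have [b0|b0] := leP 0 b.
  by exists (acos a); rewrite /expi ca sa ger0_norm.
by exists (- acos a); rewrite /expi cosN sinN ca sa ltr0_norm // opprK.
Qed.

Lemma norm_Re_le_num_radius (z : R[i]) X : `|z| = 1 ->
  N (mx_Re (z *: X)) <= num_radius N X.
Proof.
case/unit_complex_expi=> t ->; apply: sup_upper_bound.
  exact: num_radius_has_sup.
by exists t.
Qed.

(** Normalizing [x] produces [z], and [r] is the squared length of [x]. Sectors are stable under
    positive scaling, so a sector condition on the numerical range passes to the form at every
    nonzero vector. *)
Lemma num_range_sform X (x : 'cV[R[i]]_n) : x != 0 ->
  exists (r : R) (z : R[i]),
    [/\ 0 < r, num_range X z & sform X x x = r%:C%C * z].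
Proof.
move=> nzx.
have dE (y : 'cV[R[i]]_n) : cdot (X *m y) y = sform X y y.
  rewrite /cdot dotmxE /sform -mulmxA !mxE; apply: eq_bigr => i _.
  by rewrite !mxE mulrC.
have k_gt0 : 0 < cdot x x.
  rewrite /cdot dnorm_gt0; apply: contra nzx => /eqP x0.
  by rewrite -[x]trmxK x0 trmx0.
have s_gt0 : 0 < cnorm x by rewrite /cnorm sqrtC_gt0.
have kE : cnorm x ^+ 2 = cdot x x by rewrite sqrtCK.
have sr : (cnorm x)^-1^* = (cnorm x)^-1.
  by rewrite geC0_conj // invr_ge0 ltW.
exists (complex.Re (cdot x x)), (sform X ((cnorm x)^-1 *: x) ((cnorm x)^-1 *: x)).
split.
- by move: k_gt0; rewrite ltcE => /andP[].
- exists ((cnorm x)^-1 *: x); last exact: dE.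
  rewrite /= {1}/cnorm /cdot linearZ /= linearZl_LR linearZr_LR /=.
  rewrite sr -/(cdot x x) -kE expr2 mulKf ?gt_eqF // mulVf ?gt_eqF //.
  exact: sqrtC1.
rewrite RRe_real ?gtr0_real // sformZl sformZr sr -kE expr2.
by rewrite -mulrA mulVKf ?gt_eqF // mulVKf ?gt_eqF.
Qed.

Lemma norm_sectorial_le (a : R) X : unitarily_invariant N ->
  0 <= a < pi / 2 -> num_range X `<=` sector a ->
  N X <= sec a * N (mx_Re X).
Proof.
move=> hui /andP[a0 a_lt] Xa.
have pi0 : 0 < pi :> R := pi_gt0 R.
have cos_gt0 : 0 < cos a by apply: cos_gt0_pihalf; apply/andP; split; lra.
have tan_ge0 : 0 <= tan a.
  rewrite /tan divr_ge0 ?(ltW cos_gt0) //; apply: sin_ge0_pi.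
  by apply/andP; split; lra.
(* The slope of the sector is [tan a], and [sec a] is the constant matching it in the sectorial form
   bound, since [sec^2 = 1 + tan^2]. *)
pose t : R[i] := (tan a)%:C%C; pose c : R[i] := (sec a)%:C%C.
have c_gt0 : 0 < c by rewrite ltcR invr_gt0.
have t_ge0 : 0 <= t by rewrite ler0c.
have ct : c ^+ 2 = 1 + t ^+ 2.
  rewrite /c /t -!rmorphXn -(rmorph1 (real_complex R)) -rmorphD /=.
  by rewrite /sec exprVn cos2_tan2 // gt_eqF.
have Xsec x : x != 0 -> 0 < 'Re (sform X x x) /\
    `|'Im (sform X x x)| <= t * 'Re (sform X x x).
  move=> /(num_range_sform X)[r [z [r0 /Xa[re_gt0 im_le] ->]]].
  have rr : r%:C%C \is Num.real by rewrite complex_real.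
  rewrite ReMl // ImMl // -complexRe -complexIm -!rmorphM /=.
  rewrite ltcR mulr_gt0 // normc_def /= expr0n addr0 sqrtr_sqr lecR.
  by split=> //; rewrite normrM gtr0_norm // mulrCA ler_pM2l.
have : 2 * N X <= N (c *: mx_Re X) + N (c *: mx_Re X).
  apply: (norm_le_of_form hN hui) => u v; rewrite !(sformZm c) -mulrDr.
  exact: sectorial_form_bound t_ge0 c_gt0 ct Xsec u v.
rewrite (normZ_ge0 hN) ?(ltW c_gt0) //=.
by move: (sec a * _) (N X) => p q; lra.
Qed.

End NumericalRadius.

Theorem theorem2p3 (R : realType) (n : nat) (hn : (1 <= n)%N)
    (N : 'M[R[i]]_n -> R)
    (hN : mx_norm_axioms N)
    (hmul : multiplicative_norm N)
    (hui : unitarily_invariant N)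
    (hsa : self_adjoint_norm N)
    (a1 a2 : R)
    (ha1 : 0 <= a1 < pi / 2)
    (ha2 : 0 <= a2 < pi / 2)
    (X Y : 'M[R[i]]_n)
    (hX : sectorial a1 X)
    (hY : sectorial a2 Y) :
  num_radius N (hadamard X Y)
    <= sec a1 * sec a2 * num_radius N X * num_radius N Y.
Proof.
(* The rotation placing the numerical range in the sector preserves [N], and the real part of the
   rotated matrix is among those in the supremum. *)
have bound a Z : 0 <= a < pi / 2 -> sectorial a Z ->
    N Z <= sec a * num_radius N Z.
  move=> ha [z [z1 Za]]; have := norm_sectorial_le hN hui ha Za.
  rewrite normZ // z1 mul1r => /le_trans; apply.
  apply: ler_wpM2l; last exact: norm_Re_le_num_radius.
  have /andP[a0 a_lt] := ha; rewrite invr_ge0 ltW // cos_gt0_pihalf //.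
  by rewrite a_lt andbT; have := pi_gt0 R; lra.
apply: le_trans (num_radius_le hN _ hsa) _.
apply: le_trans (norm_hadamard hN hui hmul X Y) _.
have -> : sec a1 * sec a2 * num_radius N X * num_radius N Y
    = sec a1 * num_radius N X * (sec a2 * num_radius N Y).
  by rewrite mulrACA mulrA.
by apply: ler_pM (norm_ge0 hN X) (norm_ge0 hN Y) (bound _ _ ha1 hX) _;
   apply: bound.
Qed.
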